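(* Let $\theta\in[\tfrac12,1]$, $\tau>0$, $\epsilon>0$, $\beta>0$, $S_1,S_2,S_3>0$, and let $(\phi^n)_{n\ge 0}$ (functions on $\Omega$) and $(r^n)_{n\ge0}$ (real numbers) be a solution of the $\mathcal U_W$-method, i.e. for every $n\ge 1$, $$D_\tau^\theta\phi^{n+\theta}=\nabla\cdot\big(M^{*,n+\theta}\nabla\mu^{n+\theta}\big),$$ $$\mu^{n+\theta}=Z^{*,n+\theta}r^{n+\theta}+\frac{S_1}{\epsilon^2}(\phi^{n+1}-2\phi^n+\phi^{n-1})-S_2\Delta(\phi^{n+1}-2\phi^n+\phi^{n-1})+S_3\Delta^2(\phi^{n+1}-2\phi^n+\phi^{n-1}),$$ $$D_\tau^\theta r^{n+\theta}=\frac12\int_\Omega Z^{*,n+\theta}\,D_\tau^\theta\phi^{n+\theta}\,d\Omega ,$$ with starting values satisfying $\int_\Omega\phi^1d\Omega=\int_\Omega\phi^0d\Omega$. Then the scheme conserves mass: $$\int_\Omega\phi^{n+1}d\Omega=\int_\Omega\phi^{n}d\Omega=\cdots=\int_\Omega\phi^{0}d\Omega\qquad\text{for all } n\ge 0.$$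
   Context: $\Omega\subset\mathbb R^d$ ($d=2,3$) is a bounded domain; all functions satisfy periodic boundary conditions (so integration by parts produces no boundary terms) and are sufficiently regular that all expressions below are well defined. Anisotropic quantities: $\mathbf n=\nabla\phi/|\nabla\phi|$, $\gamma(\mathbf n)=1+\alpha\big(4\sum_{i=1}^d n_i^4-3\big)$ with $\alpha\ge0$, $F(\phi)=\frac14(\phi^2-1)^2$, $f(\phi)=F'(\phi)=\phi(\phi^2-1)$, $f'(\phi)=3\phi^2-1$, $$\mathbf m=\gamma(\mathbf n)\nabla\phi+\frac{\mathbb P\nabla_{\mathbf n}\gamma(\mathbf n)}{|\nabla\phi|}\Big(\tfrac12|\nabla\phi|^2+\tfrac1{\epsilon^2}F(\phi)\Big),\qquad \mathbb P=\mathbb I-\mathbf n\mathbf n^T .$$ The mobility $M(\phi)\ge M_0>0$ is a function of $\phi$ or a constant. $$Z(\phi)=\frac{\frac1{\epsilon^2}\gamma(\mathbf n)f(\phi)-\nabla\cdot\mathbf m+\beta\big(\Delta-\frac1{\epsilon^2}f'(\phi)\big)\big(\Delta\phi-\frac1{\epsilon^2}f(\phi)\big)}{\sqrt{\int_\Omega\Big(\gamma(\mathbf n)\big(\frac12|\nabla\phi|^2+\frac1{\epsilon^2}F(\phi)\big)+\frac\beta2\big(\Delta\phi-\frac1{\epsilon^2}f(\phi)\big)^2\Big)d\Omega+C}},$$ where $C>0$ is a constant making the radicand positive. Time discretization with uniform step $\tau$: for any sequence $(u^n)$, $$D_\tau^\theta u^{n+\theta}=\frac{(\theta+\frac12)u^{n+1}-2\theta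 u^n+(\theta-\frac12)u^{n-1}}{\tau},$$ $r^{n+\theta}=\theta r^{n+1}+(1-\theta)r^n$, $\phi^{*,n+\theta}=(1+\theta)\phi^n-\theta\phi^{n-1}$, $Z^{*,n+\theta}=Z(\phi^{*,n+\theta})$, $M^{*,n+\theta}=M(\phi^{*,n+\theta})$; $\mu^{n+\theta}$ is the function defined by the second equation of the scheme. *)

(* Defs.v *)
From HB Require Import structures.
From mathcomp Require Import all_boot all_order all_algebra.
From mathcomp Require Import all_classical all_reals all_analysis.
Import Order.TTheory GRing.Theory Num.Theory.
Import numFieldNormedType.Exports.

Set Implicit Arguments.
Unset Strict Implicit.
Unset Printing Implicit Defensive.

Local Open Scope classical_set_scope.
Local Open Scope ring_scope.

Section LebesgueMeasureRd.
Context (R : realType).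

(* The library has Lebesgue measure on R and binary products of sigma-finite
   measures; the d-dimensional measure is the iterated product
   lambda^(n+1) = lambda \x lambda^n, carried over to tuples along
   (x, t) |-> x :: t.  *)
Definition tcons n (p : measurableTypeR R * n.-tuple (measurableTypeR R)) :
  n.+1.-tuple (measurableTypeR R) := [tuple of p.1 :: p.2].

Lemma measurable_tcons n : measurable_fun [set: _] (@tcons n).
Proof.
exact: (measurable_cons measurable_fst measurable_snd).
Qed.

Section step.
Context (n : nat)
  (mu : {sigma_finite_measure set (n.-tuple (measurableTypeR R)) -> \bar R}).

Definition lebesgue_step : set (n.+1.-tuple (measurableTypeR R)) -> \bar R :=
  pushforward (lebesgue_measure \x mu)%E (@tcons n).

Let measurable_tcons_preimage A :
  measurable A -> measurable (@tcons n @^-1` A).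
Proof. by move=> mA; rewrite -[X in measurable X]setTI; exact: measurable_tcons. Qed.

Let lebesgue_step0 : lebesgue_step set0 = 0%E.
Proof. by rewrite /lebesgue_step /pushforward preimage_set0 measure0. Qed.

Let lebesgue_step_ge0 A : (0 <= lebesgue_step A)%E.
Proof. by rewrite /lebesgue_step /pushforward; exact: measure_ge0. Qed.

Let lebesgue_step_sigma_additive : semi_sigma_additive lebesgue_step.
Proof.
move=> F mF tF mUF; rewrite /lebesgue_step /pushforward preimage_bigcup.
apply: measure_semi_sigma_additive.
- by move=> i; exact: measurable_tcons_preimage.
- apply/trivIsetP => /= i j _ _ ij; rewrite -preimage_setI.
  by move/trivIsetP : tF => /(_ _ _ _ _ ij) ->//; rewrite preimage_set0.
- by rewrite -preimage_bigcup; exact: measurable_tcons_preimage.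
Qed.

HB.instance Definition _ := isMeasure.Build _ _ _ lebesgue_step
  lebesgue_step0 lebesgue_step_ge0 lebesgue_step_sigma_additive.

Let lebesgue_step_sigma_finite : sigma_finite [set: _] lebesgue_step.
Proof.
have /sigma_finiteP[F [FT ndF Foo]] := sigma_finiteT (@lebesgue_measure R).
have /sigma_finiteP[G [GT ndG Goo]] := sigma_finiteT mu.
exists (fun i => [set t | F i (tnth t ord0) /\ G i [tuple of behead t]]).
  apply/esym; rewrite -subTset => t _.
  have [i _ Fi] : (\bigcup_i F i) (tnth t ord0) by rewrite -FT.
  have [j _ Gj] : (\bigcup_i G i) [tuple of behead t] by rewrite -GT.
  exists (maxn i j) => //; split.
    by move: Fi; exact/subsetPset/ndF/leq_maxl.
  by move: Gj; exact/subsetPset/ndG/leq_maxr.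
move=> i; have [mF Fi] := Foo i; have [mG Gi] := Goo i; split.
  apply: measurableI; rewrite -[X in measurable X]setTI.
    exact: (measurable_tnth ord0).
  exact: measurable_behead.
rewrite /lebesgue_step /pushforward.
rewrite (_ : _ @^-1` _ = F i `*` G i); last first.
  apply/seteqP; split=> -[x t] /= [Fx Gt]; split=> //; move: Gt;
    by rewrite (_ : [tuple of behead (tcons _)] = (t : n.-tuple (measurableTypeR R)))//; exact/val_inj.
by rewrite product_measure1E// lte_mul_pinfty// ge0_fin_numE.
Qed.

HB.instance Definition _ :=
  Measure_isSigmaFinite.Build _ _ _ lebesgue_step lebesgue_step_sigma_finite.

End step.

Fixpoint lebesgue_tuple (n : nat) :
    {sigma_finite_measure set (n.-tuple (measurableTypeR R)) -> \bar R} :=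
  match n with
  | 0 => dirac ([tuple] : 0.-tuple (measurableTypeR R))
  | n'.+1 => lebesgue_step (lebesgue_tuple n')
  end.

End LebesgueMeasureRd.

Section IntegralOnRd.
Context (R : realType) (d : nat).

Definition vec (t : d.-tuple (measurableTypeR R)) : 'rV[R]_d :=
  \row_i tnth t i.

Definition integral_Rd (A : set 'rV[R]_d) (f : 'rV[R]_d -> R) : R :=
  Rintegral (lebesgue_tuple R d) (vec @^-1` A) (f \o vec).

Definition ae_on (A : set 'rV[R]_d) (P : 'rV[R]_d -> Prop) : Prop :=
  {ae lebesgue_tuple R d, forall t, A (vec t) -> P (vec t)}.

End IntegralOnRd.

Section Calculus.
Context (R : realType) (d : nat).
Implicit Types (f : 'rV[R]_d -> R) (V : 'rV[R]_d -> 'rV[R]_d).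

Definition partial (i : 'I_d) f (x : 'rV[R]_d) : R := 'D_(delta_mx 0 i) f x.

Definition grad f (x : 'rV[R]_d) : 'rV[R]_d := \row_i partial i f x.

Definition dvg V (x : 'rV[R]_d) : R := \sum_i partial i (fun y => V y 0 i) x.

Definition lap f : 'rV[R]_d -> R := dvg (grad f).

(* The library norm on 'rV[R]_d is the sup norm. *)
Definition enorm (v : 'rV[R]_d) : R := Num.sqrt (\sum_i v 0 i ^+ 2).

Fixpoint classC (k : nat) f : Prop :=
  continuous f /\
  match k with
  | 0 => True
  | k'.+1 => forall i : 'I_d,
      (forall x, derivable f x (delta_mx 0 i)) /\ classC k' (partial i f)
  end.

(* A function on the periodic cell prod_i ]a_i, b_i[ is represented by its
   periodic extension to R^d. *)
Definition cell (a b : 'rV[R]_d) : set 'rV[R]_d :=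
  [set x | forall i, a 0 i < x 0 i < b 0 i].

Definition cell_periodic (a b : 'rV[R]_d) f : Prop :=
  forall (i : 'I_d) x, f (x + (b 0 i - a 0 i) *: delta_mx 0 i) = f x.

End Calculus.

Section Model.
Context (R : realType) (d : nat) (a b : 'rV[R]_d) (alpha beta eps C : R).
Implicit Types phi : 'rV[R]_d -> R.

Definition Fpot (s : R) : R := (s ^+ 2 - 1) ^+ 2 / 4.
Definition fpot (s : R) : R := s * (s ^+ 2 - 1).
Definition dfpot (s : R) : R := 3 * s ^+ 2 - 1.

(* Where grad phi vanishes the normal is undefined on paper; here 0^-1 = 0 makes
   it 0. A periodic phi always has such points, so pointwise equations in which
   the normal occurs are to be imposed through ae_on. *)
Definition unit_normal phi (x : 'rV[R]_d) : 'rV[R]_d :=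
  (enorm (grad phi x))^-1 *: grad phi x.

Definition gamma (n : 'rV[R]_d) : R :=
  1 + alpha * (4 * (\sum_i n 0 i ^+ 4) - 3).

(* Vectors are rows, so the column-vector matrix n n^T is n^T *m n. *)
Definition tproj (n : 'rV[R]_d) : 'M[R]_d := 1%:M - n^T *m n.

(* (1/2)|grad phi|^2 + F(phi)/eps^2 *)
Definition gl_density phi (x : 'rV[R]_d) : R :=
  enorm (grad phi x) ^+ 2 / 2 + Fpot (phi x) / eps ^+ 2.

(* tproj is symmetric: the row v *m tproj n is the transpose of tproj n *m v^T. *)
Definition mvec phi (x : 'rV[R]_d) : 'rV[R]_d :=
  gamma (unit_normal phi x) *: grad phi x +
  (gl_density phi x / enorm (grad phi x)) *:
    (grad gamma (unit_normal phi x) *m tproj (unit_normal phi x)).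

Definition willmore phi (x : 'rV[R]_d) : R :=
  lap phi x - fpot (phi x) / eps ^+ 2.

Definition radicand phi : R :=
  integral_Rd (cell a b) (fun x =>
    gamma (unit_normal phi x) * gl_density phi x + beta / 2 * willmore phi x ^+ 2)
  + C.

Definition Zphi phi (x : 'rV[R]_d) : R :=
  (gamma (unit_normal phi x) * fpot (phi x) / eps ^+ 2 - dvg (mvec phi) x
   + beta * (lap (willmore phi) x - dfpot (phi x) / eps ^+ 2 * willmore phi x))
  / Num.sqrt (radicand phi).

End Model.

Section Scheme.
Context (R : realType).

(* The discrete operators at level n + theta, for n >= 1. *)
Definition Dtau (tau theta : R) (u : nat -> R) (n : nat) : R :=
  ((theta + 2^-1) * u n.+1 - 2 * theta * u n + (theta - 2^-1) * u n.-1) / tau.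

Definition interp (theta : R) (r : nat -> R) (n : nat) : R :=
  theta * r n.+1 + (1 - theta) * r n.

Definition extrap (d : nat) (theta : R) (phi : nat -> 'rV[R]_d -> R) (n : nat)
    (x : 'rV[R]_d) : R :=
  (1 + theta) * phi n x - theta * phi n.-1 x.

Definition diff2 (d : nat) (phi : nat -> 'rV[R]_d -> R) (n : nat)
    (x : 'rV[R]_d) : R :=
  phi n.+1 x - 2 * phi n x + phi n.-1 x.

End Scheme.

(* Main.v *)
Require Import Defs.
From HB Require Import structures.
From mathcomp Require Import all_boot all_order all_algebra.
From mathcomp Require Import all_classical all_reals all_analysis.
From mathcomp Require Import measurable_realfun ring lra.
Import Order.TTheory GRing.Theory Num.Theory.
Import numFieldNormedType.Exports.

(* Integrating the first equation of the scheme over the cell, the divergence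
   term vanishes: by Fubini, the integral of a partial derivative is an iterated
   integral whose innermost variable is the one of differentiation, and there
   the fundamental theorem of calculus gives a difference of two boundary values
   that agree by periodicity. The masses m_n thus satisfy the recurrence
   (theta + 1/2) m_(n+1) - 2 theta m_n + (theta - 1/2) m_(n-1) = 0, whose
   coefficients sum to zero, so that m_n = m_(n-1) forces m_(n+1) = m_n. *)

Local Open Scope classical_set_scope.
Local Open Scope ring_scope.

Section MassBalance.
Set Implicit Arguments.
Unset Strict Implicit.
Context (R : realType).
Local Notation tup n := (n.-tuple (measurableTypeR R)).
Local Notation lam := (@lebesgue_measure R).

(** * Coordinate replacement in tuples and Fubini along one coordinate *)

Definition tset {n} (i : 'I_n) (t : tup n) (s : R) : tup n :=
  [tuple if j == i then s else tnth t j | j < n].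

Lemma tnth_tset n (i : 'I_n) (t : tup n) s j :
  tnth (tset i t s) j = if j == i then s else tnth t j.
Proof. by rewrite tnth_mktuple. Qed.

Lemma tnth_tcons0 n (p : R * tup n) : tnth (tcons p) ord0 = p.1.
Proof. by []. Qed.

Lemma tnth_tconsS n (p : R * tup n) i : tnth (tcons p) (lift ord0 i) = tnth p.2 i.
Proof. by rewrite tnthS. Qed.

Lemma tset_tcons0 n (x : R) (t : tup n) s : tset ord0 (tcons (x, t)) s = tcons (s, t).
Proof.
apply: eq_from_tnth => j; rewrite tnth_tset.
by case: (unliftP ord0 j) => [k|] ->; rewrite ?eqxx// !tnth_tconsS.
Qed.

Lemma tset_tconsS n (i : 'I_n) (x : R) (t : tup n) s :
  tset (lift ord0 i) (tcons (x, t)) s = tcons (x, tset i t s).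
Proof.
apply: eq_from_tnth => j; rewrite tnth_tset.
case: (unliftP ord0 j) => [k|] ->; rewrite ?tnth_tcons0//.
by rewrite !tnth_tconsS tnth_tset (inj_eq lift_inj).
Qed.

Local Open Scope ereal_scope.

(** The measure on [n.+1]-tuples is the pushforward of the product measure along [tcons]. The change
    of variables for nonnegative functions, applied to the absolute value of [h], suffices; the
    signed one in [integral_tcons] then relies on this result. *)
Lemma integrable_tcons n (h : tup n.+1 -> \bar R) :
  (lebesgue_tuple R n.+1).-integrable setT h ->
  (lam \x lebesgue_tuple R n).-integrable setT (h \o @tcons R n).
Proof.
move=> /integrableP[mh ih]; apply/integrableP; split.
  exact: (measurableT_comp mh (@measurable_tcons R n)).
apply: le_lt_trans ih; rewrite /= /lebesgue_step.
rewrite ge0_integral_pushforward//.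
  exact: measurable_tcons.
exact: measurableT_comp.
Qed.

Lemma integral_tcons n (h : tup n.+1 -> \bar R) :
  (lebesgue_tuple R n.+1).-integrable setT h ->
  \int[lebesgue_tuple R n.+1]_t h t =
  \int[lam \x lebesgue_tuple R n]_p h (tcons p).
Proof.
move=> ih; have mh := measurable_int _ ih.
have ihc := integrable_tcons ih.
rewrite /= /lebesgue_step integral_pushforward//.
exact: measurable_tcons.
Qed.

(* The sections h (x :: _) are integrable only for almost every x, so the
   induction hypothesis applies only almost everywhere. *)
Lemma integral_lines_eq0 n (i : 'I_n) (h : tup n -> \bar R) :
  (lebesgue_tuple R n).-integrable setT h ->
  (forall t, \int[lam]_s h (tset i t s) = 0) ->
  \int[lebesgue_tuple R n]_t h t = 0.
Proof.
elim: n i h => [[]//|n IHn] i h ih h0.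
have ihc := integrable_tcons ih; rewrite integral_tcons//.
case: (unliftP ord0 i) => [k|] ik.
(* The coordinate [i] lies in the tail: the tail is integrated first, and the induction hypothesis
   makes the inner integral vanish for almost every head [x]. *)
- rewrite -(integral12_prod_meas1 ihc).
  rewrite (@ae_eq_integral _ _ _ _ _ (cst 0))//=; first exact: integral0.
    exact: measurable_fubini_F ihc.
  have := ae_integrable1 ihc; apply: filterS => x ix _.
  apply: (IHn k) => // t; rewrite -[RHS](h0 (tcons (x, t))).
  by apply: eq_integral => s _; rewrite ik tset_tconsS.
- rewrite -(integral21_prod_meas1 ihc) /fubini_G.
  rewrite [LHS](_ : _ = \int[lebesgue_tuple R n]_t cst 0 t); first exact: integral0.
  (* Here [i] is the head, integrated first. The entry [0] is a placeholder that [tset ord0]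
     overwrites. *)
  apply: eq_integral => t _; rewrite /= -[RHS](h0 (tcons (0%R, t))).
  by apply: eq_integral => s _; rewrite ik tset_tcons0.
Qed.

Local Close Scope ereal_scope.

(** * Measurability and finite measure of the cell, integrability of continuous functions *)

Lemma vec_preimage_cell n (a b : 'rV[R]_n) :
  @vec R n @^-1` cell a b = [set t : tup n | forall i, a 0 i < tnth t i < b 0 i].
Proof. by apply/seteqP; split=> t /= h i; move: (h i); rewrite mxE. Qed.

Lemma measurable_cell n (a b : 'rV[R]_n) : measurable (@vec R n @^-1` cell a b).
Proof.
rewrite vec_preimage_cell.
rewrite (_ : mkset _ = \bigcap_(i in [set: 'I_n])
    ((fun t : tup n => tnth t i) @^-1` `]a 0 i, b 0 i[)).
  apply: fin_bigcap_measurable => // i _; rewrite -[X in measurable X]setTI.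
  by apply: (measurable_tnth i) => //; exact: measurable_itv.
by apply/seteqP; split=> t /= h i => [_|]; have := h i; rewrite /= in_itv//=; exact.
Qed.

(** Through [tcons] the cell becomes a bounded interval times a cell of one dimension less, whose
    corners [a'] and [b'] drop the first coordinate. *)
Lemma lebesgue_tuple_cell_lty n (a b : 'rV[R]_n) :
  (lebesgue_tuple R n (@vec R n @^-1` cell a b) < +oo)%E.
Proof.
elim: n a b => [|n IHn] a b.
  by rewrite /= diracE ltry.
rewrite /= /lebesgue_step /pushforward.
pose a' : 'rV[R]_n := \row_i a 0 (lift ord0 i).
pose b' : 'rV[R]_n := \row_i b 0 (lift ord0 i).
rewrite (_ : _ @^-1` _ = `]a 0 ord0, b 0 ord0[ `*` (@vec R n @^-1` cell a' b')); last first.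
  rewrite !vec_preimage_cell; apply/seteqP; split=> -[x t]/=.
    move=> h; split; first by have := h ord0; rewrite in_itv tnth_tcons0.
    by move=> i; have := h (lift ord0 i); rewrite !mxE tnth_tconsS.
  move=> [h0 h] i; case: (unliftP ord0 i) => [k|] ->.
    by have := h k; rewrite !mxE tnth_tconsS.
  by move: h0; rewrite in_itv.
rewrite product_measure1E//; last exact: measurable_cell.
rewrite lte_mul_pinfty//.
  by rewrite ge0_fin_numE//= lebesgue_measure_itv/=; case: ifP => // _; rewrite ltry.
Qed.

(** This links the topology of row vectors with the product sigma-algebra of tuples: an open set is
    the countable union of the rational boxes it contains. Boxes not contained in [O] are replaced
    by [set0], so the union runs over a whole countable type. *)
Lemma measurable_vec_open n (O : set 'rV[R]_n) :
  open O -> measurable (@vec R n @^-1` O).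
Proof.
move=> oO.
pose rv (q : {ffun 'I_n -> rat}) : 'rV[R]_n := \row_i ratr (q i).
pose F (pq : {ffun 'I_n -> rat} * {ffun 'I_n -> rat}) : set (tup n) :=
  if `[< cell (rv pq.1) (rv pq.2) `<=` O >]
  then @vec R n @^-1` cell (rv pq.1) (rv pq.2) else set0.
rewrite (_ : _ @^-1` _ = \bigcup_pq F pq).
  apply: countable_bigcupT_measurable; first exact: countableP.
  move=> pq; rewrite /F; case: ifPn => _; last exact: measurable0.
  exact: measurable_cell.
apply/seteqP; split=> t /=; last first.
  by move=> [pq _]; rewrite /F; case: asboolP => // sub; exact: sub.
move=> Ot; have /nbhs_ballP[e /= e0 eO] := open_nbhs_nbhs (conj oO Ot).
have /choice[p hp] i : exists q : rat, tnth t i - e < ratr q < tnth t i.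
  have : tnth t i - e < tnth t i by rewrite ltrBlDr ltrDl.
  by move=> /rat_in_itvoo[q]; rewrite in_itv => h; exists q.
have /choice[q hq] i : exists q : rat, tnth t i < ratr q < tnth t i + e.
  have : tnth t i < tnth t i + e by rewrite ltrDl.
  by move=> /rat_in_itvoo[r]; rewrite in_itv => h; exists r.
exists (finfun p, finfun q) => //; rewrite /F; case: asboolP => [_|]/=.
  move=> i; rewrite !mxE !ffunE; apply/andP; split.
    by have /andP[] := hp i.
  by have /andP[] := hq i.
(* The chosen box lies in [O]: its sides stay within [e] of [t], and a ball of the sup norm is
   itself a box. *)
case=> y hy; apply: eO; split=> // i j; rewrite ord1 mxE.
have := hy j; rewrite !mxE !ffunE => /andP[py yq].
have /andP[tp _] := hp j; have /andP[_ qt] := hq j.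
rewrite /ball/= ltr_distlC; apply/andP; split.
  exact: lt_trans py.
exact: lt_trans yq qt.
Qed.

Lemma measurable_continuous_vec n (f : 'rV[R]_n -> R) :
  continuous f -> measurable_fun [set: tup n] (f \o @vec R n).
Proof.
move=> /continuousP cf; apply: (measurability _ (RGenOpens.measurableE R)).
move=> _ [_ [x [y ->] <-]]; rewrite setTI comp_preimage.
by apply: (@measurable_vec_open n (f @^-1` `]x, y[)); apply: cf; exact: interval_open.
Qed.

(** Continuity on the whole space bounds [f] on the compact closed box, hence on the cell, which has
    finite measure. *)
Lemma integrable_cell n (a b : 'rV[R]_n) (f : 'rV[R]_n -> R) :
  continuous f ->
  (lebesgue_tuple R n).-integrable (@vec R n @^-1` cell a b)
    (EFin \o (f \o @vec R n)).
Proof.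
move=> cf; apply: measurable_bounded_integrable.
- exact: measurable_cell.
- exact: lebesgue_tuple_cell_lty.
- by apply: measurable_funTS; apply: measurable_continuous_vec.
have : compact (f @` [set v : 'rV[R]_n | forall i, `[a 0 i, b 0 i]%classic (v ord0 i)]).
  apply: continuous_compact; first exact: continuous_subspaceT.
  by apply: (@rV_compact R n (fun i => `[a 0 i, b 0 i]%classic)) => i; exact: segment_compact.
move=> /compact_bounded[M [Mr hM]]; exists M; split=> // x /hM h t/= ct.
apply: h; exists (vec t) => // i; have /andP[ai bi] := ct i.
by rewrite /= in_itv/= !ltW.
Qed.

(** * Differentiation along lines and the integral of a partial derivative *)

Lemma integral_FTC_periodic (G g : R -> R) (a b : R) : a < b ->
  (forall s : R, is_derive s 1 G (g s)) -> continuous g -> G b = G a ->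
  (\int[lam]_(s in `]a, b[) (g s)%:E = 0)%E.
Proof.
move=> ab dG cg Gba.
have Gd (s : R) : derivable G s 1 by have [] := dG s.
have Gc : continuous G.
  by move=> s; exact/differentiable_continuous/derivable1_diffP.
(* The flags [true false] pass to the closed interval, on which the fundamental theorem of calculus
   is stated. *)
rewrite -(@integral_itv_bndoo _ a b (EFin \o g) true false)/=; last first.
  apply/measurable_EFinP; apply: measurable_funTS.
  exact: continuous_measurable_fun.
rewrite (@continuous_FTC2 R g G a b ab).
- by rewrite Gba -EFinB subrr.
- exact: continuous_subspaceT.
- by split => //; [apply: cvg_at_right_filter|apply: cvg_at_left_filter]; exact: Gc.
- by move=> s _; rewrite derive1E; have [_ ->] := dG s.
Qed.

Lemma is_derive_line (V : normedModType R) (f : V -> R) (y v : V) (s : R) :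
  derivable f (s *: v + y) v ->
  is_derive s 1 (fun h : R => f (h *: v + y)) ('D_v f (s *: v + y)).
Proof.
have E : (fun h : R => h^-1 *: (f ((h *: 1 + s) *: v + y) - f (s *: v + y))) =
         (fun h : R => h^-1 *: (f (h *: v + (s *: v + y)) - f (s *: v + y))).
  by apply/funext => h; rewrite addrA -scalerDl [h *: 1]mulr1.
by move=> df; split; rewrite /derivable /derive/= E.
Qed.

(** Only a directional derivative of [f] is assumed, so the chain rule is applied in one variable,
    to the restriction [L] of [f] to the line through [x] with direction [v]. *)
Lemma is_derive_comp (V : normedModType R) (f : V -> R) (g : R -> R) (x v : V) :
  derivable f x v -> derivable g (f x) 1 ->
  is_derive x v (g \o f) (derive1 g (f x) * 'D_v f x).
Proof.
move=> df dg; set L := fun h : R => f (h *: v + x).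
have L0 : L 0 = f x by rewrite /L scale0r add0r.
have dL : is_derive (0 : R) 1 L ('D_v f x).
  by have := @is_derive_line _ f x v 0; rewrite scale0r add0r; exact.
have dgL : is_derive (0 : R) 1 (g \o L) ('D_v f x * derive1 g (f x)).
  have dg' : is_derive (L 0) 1 g (derive1 g (f x)).
    by rewrite L0 derive1E; exact: derivableP.
  by rewrite mulrC; exact: is_derive1_comp.
have [d1 d2] := dgL.
have dgf : derivable (g \o f) x v by apply/derivable1P.
split=> //; rewrite mulrC -d2.
have := @is_derive_line _ (g \o f) x v 0; rewrite scale0r add0r => /(_ dgf)[_ <-].
by [].
Qed.

(** Replacing an entry is moving along a line. The base point has [i]-th entry [0], so the parameter
    [s] is the coordinate itself. *)
Lemma vec_tset n (i : 'I_n) (t : tup n) (s : R) :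
  vec (tset i t s) = s *: delta_mx 0 i + vec (tset i t 0).
Proof.
apply/rowP => j; rewrite !mxE !tnth_tset eqxx/=.
by case: eqVneq => _; rewrite ?mulr1 ?mulr0 ?addr0 ?add0r.
Qed.

Lemma integral_partial_periodic n (a b : 'rV[R]_n) (i : 'I_n) (f : 'rV[R]_n -> R) :
  a 0 i < b 0 i ->
  (forall x, derivable f x (delta_mx 0 i)) -> continuous (partial i f) ->
  cell_periodic a b f ->
  integral_Rd (cell a b) (partial i f) = 0.
Proof.
move=> ab df cf pf; rewrite /integral_Rd /Rintegral.
(* Extending the integrand by zero outside the cell makes the statement about whole lines
   applicable. *)
rewrite integral_mkcond (@integral_lines_eq0 _ i)//.
  apply/(integrable_mkcond _ _).1; first exact: measurable_cell.
  exact: integrable_cell.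
move=> t; set y := vec (tset i t 0).
(* If another coordinate of [t] is out of range, the line misses the cell and the integrand is zero;
   otherwise it meets the cell exactly for [s] in []a 0 i, b 0 i[]. *)
have [ht|ht] := pselect (forall j, j != i -> a 0 j < tnth t j < b 0 j); last first.
  rewrite -[RHS](integral0 lam setT); apply: eq_integral => s _.
  rewrite /= patchE ifF//; apply/negbTE/negP; rewrite inE => hs.
  apply: ht => j ji; have := hs j.
  by rewrite mxE tnth_tset (negbTE ji).
rewrite -[RHS](@integral_FTC_periodic (fun s : R => f (s *: delta_mx 0 i + y))
  (fun s => partial i f (s *: delta_mx 0 i + y)) (a 0 i) (b 0 i))//.
- rewrite [RHS]integral_mkcond; apply: eq_integral => s _.
  rewrite !patchE/=.
  have -> : (tset i t s \in @vec R n @^-1` cell a b) = (s \in `]a 0 i, b 0 i[%classic).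
    apply/idP/idP; rewrite !inE/= in_itv/=.
      by move=> /(_ i); rewrite mxE tnth_tset eqxx.
    move=> h j; rewrite mxE tnth_tset.
    by case: eqVneq => [->//|]; exact: ht.
  by case: ifP => //; rewrite vec_tset.
- by move=> s; exact: is_derive_line.
- move=> s; apply: continuous_comp; last exact: cf.
  by apply: cvgD; [apply: cvgZr_tmp|exact: cvg_cst]; exact: cvg_id.
(* The two end points of the line differ by one period in direction [i]. *)
- by rewrite -(pf i (a 0 i *: _ + y)) addrAC -scalerDl addrCA subrr addr0.
Qed.

(* Stated over an abstract T: on 'rV[R]_d, introducing the point unfolds the
   neighbourhood filter and the cvg lemmas no longer apply. *)
Lemma continuous_add (T : topologicalType) (f g : T -> R) :
  continuous f -> continuous g -> continuous (fun x => f x + g x).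
Proof. by move=> cf cg x; apply: cvgD; [exact: cf|exact: cg]. Qed.

Lemma continuous_sub (T : topologicalType) (f g : T -> R) :
  continuous f -> continuous g -> continuous (fun x => f x - g x).
Proof. by move=> cf cg x; apply: cvgB; [exact: cf|exact: cg]. Qed.

Lemma continuous_mul (T : topologicalType) (f g : T -> R) :
  continuous f -> continuous g -> continuous (fun x => f x * g x).
Proof. by move=> cf cg x; apply: cvgM; [exact: cf|exact: cg]. Qed.

(** * Linearity of the integral over the cell and the periodic divergence theorem *)

Section Cell.
Context (d : nat) (a b : 'rV[R]_d).
Implicit Types f g p q : 'rV[R]_d -> R.

Lemma integral_RdD f g : continuous f -> continuous g ->
  integral_Rd (cell a b) (fun x => f x + g x) =
  integral_Rd (cell a b) f + integral_Rd (cell a b) g.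
Proof.
by move=> cf cg; apply: RintegralD;
  [exact: measurable_cell|exact: integrable_cell|exact: integrable_cell].
Qed.

Lemma integral_RdZ (c : R) f : continuous f ->
  integral_Rd (cell a b) (fun x => c * f x) = c * integral_Rd (cell a b) f.
Proof.
by move=> cf; apply: RintegralZl; [exact: measurable_cell|exact: integrable_cell].
Qed.

Lemma integral_Rd_sum I (s : seq I) (F : I -> 'rV[R]_d -> R) :
  (forall i, continuous (F i)) ->
  integral_Rd (cell a b) (fun x => \sum_(i <- s) F i x) =
  \sum_(i <- s) integral_Rd (cell a b) (F i).
Proof.
move=> cF; elim: s => [|i s IHs].
  rewrite big_nil -[RHS](mul0r (integral_Rd (cell a b) (cst 0))) -integral_RdZ;
    last exact: cst_continuous.
  by congr integral_Rd; apply/funext => x; rewrite big_nil mul0r.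
rewrite big_cons -IHs -integral_RdD//; last first.
  by apply: continuous_big => //; exact: add_continuous.
by congr integral_Rd; apply/funext => x; rewrite big_cons.
Qed.

Lemma eq_integral_Rd (A : set 'rV[R]_d) f g :
  (forall x, A x -> f x = g x) -> integral_Rd A f = integral_Rd A g.
Proof. by move=> fg; apply: eq_Rintegral => t; rewrite inE; exact: fg. Qed.

Lemma integral_dvg_periodic (V : 'rV[R]_d -> 'rV[R]_d) :
  (forall i, a 0 i < b 0 i) ->
  (forall i x, derivable (fun y => V y 0 i) x (delta_mx 0 i)) ->
  (forall i, continuous (partial i (fun y => V y 0 i))) ->
  (forall i, cell_periodic a b (fun y => V y 0 i)) ->
  integral_Rd (cell a b) (dvg V) = 0.
Proof.
move=> ab dV cV pV; rewrite /dvg integral_Rd_sum//.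
by apply: big1 => i _; exact: integral_partial_periodic.
Qed.

(** Translation by a period leaves every difference quotient unchanged. *)
Lemma cell_periodic_partial i f :
  cell_periodic a b f -> cell_periodic a b (partial i f).
Proof.
move=> pf j x; rewrite /partial /derive; by under eq_fun do rewrite /shift/= addrA !pf.
Qed.

(** * Regularity and vanishing integral of the flux *)

Lemma classCW k f : classC k.+1 f -> classC k f.
Proof.
elim: k f => [|k IHk] f [cf hf]; split=> // i.
by have [df /IHk] := hf i.
Qed.

Lemma classC_le k l f : (k <= l)%N -> classC l f -> classC k f.
Proof.
by move=> /subnK <-; elim: (l - k)%N => [//|m IHm] /classCW.
Qed.

(** The combination has the shape of [extrap], with [s = 1 + theta] and [t = theta]. *)
Lemma classC1_lin (s t : R) f g :
  classC 1 f -> classC 1 g -> classC 1 (fun x => s * f x - t * g x).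
Proof.
move=> [cf hf] [cg hg]; split.
  by apply: continuous_sub; (apply: continuous_mul; first exact: cst_continuous);
    [exact: cf|exact: cg].
move=> i; have [df [cdf _]] := hf i; have [dg [cdg _]] := hg i.
have D x : is_derive x (delta_mx 0 i) ((s \*: f) - (t \*: g))
    (s *: partial i f x - t *: partial i g x).
  by apply: is_deriveB; apply: is_deriveZ; exact: derivableP.
split; first by move=> x; have [] := D x.
split; last by [].
rewrite (_ : partial i _ = (fun x => s *: partial i f x - t *: partial i g x)).
  by apply: continuous_sub; (apply: continuous_mul; first exact: cst_continuous);
    [exact: cdf|exact: cdg].
by apply/funext => x; have [_] := D x.
Qed.

Lemma classC1_comp (M : R -> R) f :
  (forall s : R, derivable M s 1) -> continuous (derive1 M) ->
  classC 1 f -> classC 1 (M \o f).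
Proof.
move=> dM cM [cf hf]; split.
  move=> x; apply: continuous_comp; first exact: cf.
  exact/differentiable_continuous/derivable1_diffP.
move=> i; have [df [cdf _]] := hf i.
have D x := is_derive_comp (df x) (dM (f x)).
split; first by move=> x; have [] := D x.
split; last by [].
rewrite (_ : partial i _ = (fun x => derive1 M (f x) * partial i f x)).
  apply: continuous_mul; last exact: cdf.
  by move=> x; apply: (@continuous_comp _ _ _ f (derive1 M)); [exact: cf|exact: cM].
by apply/funext => x; have [_] := D x.
Qed.

Lemma classC1M f g : classC 1 f -> classC 1 g -> classC 1 (fun x => f x * g x).
Proof.
move=> [cf hf] [cg hg]; split.
  exact: continuous_mul.
move=> i; have [df [cdf _]] := hf i; have [dg [cdg _]] := hg i.
have D x : is_derive x (delta_mx 0 i) (f * g)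
    (f x *: partial i g x + g x *: partial i f x).
  by apply: is_deriveM; exact: derivableP.
split; first by move=> x; have [] := D x.
split; last by [].
rewrite (_ : partial i _ = (fun x => f x *: partial i g x + g x *: partial i f x)).
  by apply: continuous_add; apply: continuous_mul;
    [exact: cf|exact: cdg|exact: cg|exact: cdf].
by apply/funext => x; have [_] := D x.
Qed.

(** Each flux component is the product of [M \o p] and [partial i q], both C1 and periodic, so the
    periodic divergence theorem applies. *)
Lemma integral_dvg_flux (M : R -> R) p q :
  (forall i, a 0 i < b 0 i) ->
  (forall s : R, derivable M s 1) -> continuous (derive1 M) ->
  classC 1 p -> classC 2 q -> cell_periodic a b p -> cell_periodic a b q ->
  integral_Rd (cell a b) (dvg (fun y => M (p y) *: grad q y)) = 0.
Proof.
move=> ab dM cM Cp [_ Cq] pp pq.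
have E i : (fun y => (M (p y) *: grad q y) 0 i) = (fun y => (M \o p) y * partial i q y).
  by apply/funext => y; rewrite !mxE.
have CV i : classC 1 (fun y => (M (p y) *: grad q y) 0 i).
  rewrite E; apply: classC1M; first exact: classC1_comp.
  by have [] := Cq i.
apply: integral_dvg_periodic => // i.
- by have [_ /(_ i)[]] := CV i.
- by have [_ /(_ i)[_ []]] := CV i.
- by move=> j x; rewrite !mxE pp cell_periodic_partial.
Qed.

Lemma integral_Dtau (tau theta : R) (phi : nat -> 'rV[R]_d -> R) n :
  (forall k, continuous (phi k)) ->
  integral_Rd (cell a b) (fun x => Dtau tau theta (fun k => phi k x) n) =
  Dtau tau theta (fun k => integral_Rd (cell a b) (phi k)) n.
Proof.
move=> cphi; rewrite /Dtau.
set A := (theta + 2^-1) / tau; set B := - (2 * theta) / tau.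
set C := (theta - 2^-1) / tau.
have cA k (c : R) : continuous (fun x => c * phi k x).
  by apply: continuous_mul => //; exact: cst_continuous.
transitivity (integral_Rd (cell a b)
    (fun x => A * phi n.+1 x + (B * phi n x + C * phi n.-1 x))).
  by apply: eq_integral_Rd => x _; rewrite /A /B /C; ring.
have cBC : continuous (fun x => B * phi n x + C * phi n.-1 x).
  exact: continuous_add.
by rewrite !integral_RdD ?integral_RdZ// /A /B /C; ring.
Qed.

End Cell.

End MassBalance.

Theorem theorem3p4 (R : realType) (d : nat) (hd : d = 2%N \/ d = 3%N)
  (a b : 'rV[R]_d) (hab : forall i, a 0 i < b 0 i)
  (alpha beta eps C tau theta S1 S2 S3 M0 : R)
  (halpha : 0 <= alpha) (hbeta : 0 < beta) (heps : 0 < eps) (hC : 0 < C)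
  (htau : 0 < tau) (htheta : 2^-1 <= theta <= 1)
  (hS1 : 0 < S1) (hS2 : 0 < S2) (hS3 : 0 < S3)
  (M : R -> R) (hM0 : 0 < M0) (hM : forall s, M0 <= M s)
  (hMC1 : (forall s, derivable M s 1) /\ continuous (derive1 M))
  (phi mu : nat -> 'rV[R]_d -> R) (r : nat -> R)
  (hphi_per : forall n, cell_periodic a b (phi n))
  (hphi_reg : forall n, classC 4 (phi n))
  (hmu_per : forall n, (1 <= n)%N -> cell_periodic a b (mu n))
  (hmu_reg : forall n, (1 <= n)%N -> classC 2 (mu n))
  (hrad : forall n, (1 <= n)%N ->
    0 < radicand a b alpha beta eps C (extrap theta phi n))
  (scheme_phi : forall n, (1 <= n)%N -> forall x, cell a b x ->
    Dtau tau theta (fun k => phi k x) n =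
    dvg (fun y => M (extrap theta phi n y) *: grad (mu n) y) x)
  (scheme_mu : forall n, (1 <= n)%N -> ae_on (cell a b) (fun x =>
    mu n x =
    Zphi a b alpha beta eps C (extrap theta phi n) x * interp theta r n
    + S1 / eps ^+ 2 * diff2 phi n x
    - S2 * lap (diff2 phi n) x
    + S3 * lap (lap (diff2 phi n)) x))
  (scheme_r : forall n, (1 <= n)%N ->
    Dtau tau theta r n =
    2^-1 * integral_Rd (cell a b) (fun x =>
      Zphi a b alpha beta eps C (extrap theta phi n) x
      * Dtau tau theta (fun k => phi k x) n))
  (hstart : integral_Rd (cell a b) (phi 1%N) =
            integral_Rd (cell a b) (phi 0%N)) :
  forall n : nat,
    integral_Rd (cell a b) (phi n.+1) = integral_Rd (cell a b) (phi n) /\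
    integral_Rd (cell a b) (phi n) = integral_Rd (cell a b) (phi 0%N).
Proof.
have [dM cM] := hMC1; have /andP[theta_ge _] := htheta.
have Cphi n : classC 1 (phi n) by exact: classC_le (hphi_reg n).
pose m n := integral_Rd (cell a b) (phi n).
have recm n : (1 <= n)%N -> Dtau tau theta m n = 0.
  move=> n1; rewrite -integral_Dtau; last by move=> k; have [] := Cphi k.
  (* The first equation holds at every point of the open cell, which is the domain of
     integration. *)
  rewrite (eq_integral_Rd (scheme_phi n n1)).
  apply: integral_dvg_flux.
  - exact: hab.
  - exact: dM.
  - exact: cM.
  - exact: classC1_lin (Cphi n) (Cphi n.-1).
  - exact: hmu_reg.
  - by move=> i x; rewrite /extrap !hphi_per.
  - exact: hmu_per.
have stepm n : m n.+1 = m n.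
  elim: n => [|n IHn]; first exact: hstart.
  move: (recm n.+1 isT); rewrite /Dtau /= IHn => /eqP.
  rewrite mulf_eq0 invr_eq0 (gt_eqF htau) orbF => /eqP rec.
  (* With [m n.+1 = m n], the last two coefficients of the recurrence add up to
     [- (theta + 2^-1)]. *)
  have : (theta + 2^-1) * (m n.+2 - m n) = 0 by rewrite -rec; field.
  (* The factor [theta + 2^-1] is at least 1 because [theta >= 2^-1], so the other factor
     vanishes. *)
  move=> /eqP; rewrite mulf_eq0 subr_eq0 => /orP[/eqP|/eqP//]; lra.
move=> n; split; first exact: stepm.
by elim: n => // n; rewrite -/(m n) -/(m n.+1) stepm.
Qed.
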